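(* Let $A\in\mathbb{R}^{n\times n}$ and $B\in\mathbb{R}^{n\times m}$, and assume that the pair $(A,B)$ is controllable. Let $\mu$ be the largest controllability index of $(A,B)$, that is, $$\mu:=\min\{j\ge 1:\operatorname{rank}[B,AB,\ldots,A^{j-1}B]=n\}.$$ Then there exist constants $c_0,C_0,\delta_0>0$, depending only on $(A,B)$, such that $$c_0\,\delta^{\mu-1}\le \widehat C(\delta)\le C_0\,\delta^{\mu-1}\qquad\text{for all }\delta\ge\delta_0.$$ Moreover, $$\lim_{\delta\to+\infty}\frac{\log\widehat C(\delta)}{\log\delta}=\mu-1.$$ If $\mu=1$, equivalently $\operatorname{rank}B=n$, then $\widehat C(\delta)=1$ for every $\delta>0$.
   Context: $\mathbb{R}^n$ carries the Euclidean norm and $\|\cdot\|$ also denotes the induced operator norm on matrices. The pair $(A,B)$ is controllable if $\operatorname{rank}[B,AB,\ldots,A^{n-1}B]=n$. For $\delta>0$ the optimal stabilization prefactor of $(A,B)$ is $$\widehat C(\delta):=\inf_{K\in\mathbb{R}^{m\times n}}\ \sup_{t\ge 0}\ e^{\delta t}\,\|e^{(A+BK)t}\|\in[1,+\infty].$$ *)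

(* Defs.v *)
From HB Require Import structures.
From mathcomp Require Import all_boot all_order all_algebra.
From mathcomp Require Import all_classical all_reals all_analysis.
Set Implicit Arguments.
Unset Strict Implicit.
Unset Printing Implicit Defensive.
Import Order.TTheory GRing.Theory Num.Theory.
Import numFieldNormedType.Exports.
Local Open Scope classical_set_scope.
Local Open Scope ring_scope.

(* The library norm on matrices is the maximum of the absolute values of the
   entries, so the Euclidean norm and its induced norm are defined here. *)
Definition enorm (R : realType) (n : nat) (x : 'cV[R]_n) : R :=
  Num.sqrt (\sum_(i < n) x i 0 ^+ 2).

Definition opnorm (R : realType) (n : nat) (M : 'M[R]_n) : R :=
  sup [set enorm (M *m x) | x in [set x : 'cV[R]_n | enorm x <= 1]].

(* The limit is taken in the library topology on matrices, which is that of
   entrywise convergence. *)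
Definition expmx (R : realType) (n : nat) (M : 'M[R]_n) : 'M[R]_n :=
  lim (series (fun k : nat => (k`!%:R)^-1 *: M ^+ k) @ \oo).

(* [B, AB, ..., A^(j-1) B] *)
Definition ctrbmx (R : realType) (n m : nat) (A : 'M[R]_n) (B : 'M[R]_(n, m))
    (j : nat) : 'M[R]_(n, \sum_(i < j) m) :=
  \mxrow_(i < j) (A ^+ i *m B).

Definition controllable (R : realType) (n m : nat)
    (A : 'M[R]_n) (B : 'M[R]_(n, m)) : bool :=
  \rank (ctrbmx A B n) == n.

Lemma ctrb_index_ex (R : realType) (n m : nat)
    (A : 'M[R]_n) (B : 'M[R]_(n, m)) (hAB : controllable A B) :
  exists j : nat, (1 <= j)%N && (\rank (ctrbmx A B j) == n).
Proof.
case: n => [|n] in A B hAB *; last by exists n.+1.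
by exists 1%N; rewrite /= -leqn0 rank_leq_row.
Qed.

Definition ctrb_index (R : realType) (n m : nat)
    (A : 'M[R]_n) (B : 'M[R]_(n, m)) (hAB : controllable A B) : nat :=
  ex_minn (ctrb_index_ex hAB).

Definition stab_prefactor (R : realType) (n m : nat)
    (A : 'M[R]_n) (B : 'M[R]_(n, m)) (delta : R) : \bar R :=
  ereal_inf [set ereal_sup
      [set (expR (delta * t) * opnorm (expmx (t *: (A + B *m K))))%:E
        | t in [set t : R | 0 <= t]]
    | K in [set: 'M[R]_(m, n)]].

(* Main.v *)
Require Import Defs.
From HB Require Import structures.
From mathcomp Require Import all_boot all_order all_algebra.
From mathcomp Require Import all_classical all_reals all_analysis.
From mathcomp Require Import ring lra.
Set Implicit Arguments.
Unset Strict Implicit.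
Unset Printing Implicit Defensive.
Import Order.TTheory GRing.Theory Num.Theory.
Import numFieldNormedType.Exports.
Local Open Scope classical_set_scope.
Local Open Scope ring_scope.

(** Let d = mu - 1.

    Lower bound. As the controllability matrix with d blocks is not of full
    rank, there is a row q <> 0 with q A^i B = 0 for i < d. For every gain K and
    F = A + B K this gives q F^i = q A^i for i <= d, so the first d derivatives
    of f(t) = q exp(t F) q^T are q A^i exp(t F) q^T, where K enters only through
    the exponential. If exp(t F) is bounded by C exp(- delta t), then the d-th
    derivative is O(C exp(- delta t)), and integrating it d times from infinity
    gives |q|^2 = f(0) = O(C / delta^d), that is, C >= c delta^d
    (decay_rate_lower).

    Upper bound. For each large delta a gain is built from a positive definite W
    with A W + W A^T + 2 delta W <= B B^T / (2 delta): for K = - B^T W^-1 /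
    (4 delta) the form r W r^T decreases at rate 2 delta along the rows of the
    exponential of t (A + B K), so the prefactor is at most the square root of
    the condition number of W (bass_feedback_decay). The choice of W is the
    finite sum over k <= d of G_k G_k^T, where G_k = A^k N^(k+1) B and
    N = (A + 2 delta)^-1. The inequality holds because its two sides telescope
    (shifted_gramian_lyapunov). For the condition number, r W r^T is clearly
    O(delta^-2 |r|^2). Conversely it dominates all |r A^j N^(d+1) B|^2 with
    j <= d (shifted_gramian_dominates), hence |r N^(d+1)|^2 by full rank of the
    controllability matrix with d + 1 blocks, hence delta^(-2(d+1)) |r|^2. The
    condition number is thus O(delta^(2d)) (stab_prefactor_upper).

    The limit of the quotient of logarithms follows from the two bounds. When
    rank B = n, some K makes A + B K equal to - delta times the identity, and
    the prefactor is never below its value 1 at time 0. *)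

(** * Scalar forms of the matrix exponential *)

Lemma cvg_mx_entry (R : realType) (p q : nat) (u : nat -> 'M[R]_(p, q))
    (M : 'M[R]_(p, q)) :
  (forall i j, (fun k => u k i j) @ \oo --> M i j) -> u @ \oo --> M.
Proof.
move=> uM; apply/cvgrPdist_le => /= e e0; near=> k.
rewrite /Num.Def.normr/= mx_normrE (bigmax_le _ (ltW e0))//= => i _.
rewrite !mxE; move: i; near: k; apply: filter_forall => /= i.
by have /cvgrPdist_le := uM i.1 i.2; apply.
Unshelve. all: by end_near. Qed.

(** The growth of the coefficients that makes their exponential generating
    function entire; powers of a matrix, and linear forms in them, have it. *)
Definition geom_bounded (R : realType) (a : nat -> R) :=
  exists b s : R, forall k, `|a k| <= b * s ^+ k.

(** The exponential generating function of a sequence. Every scalar read off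
    from exp (t M) has this form, and differentiating it shifts the sequence, so
    that no derivative of a matrix-valued function is needed. *)
Definition egf (R : realType) (a : nat -> R) (t : R) : R :=
  limn (pseries (fun k => a k / k`!%:R) t).

Lemma egf_cvg (R : realType) (a : nat -> R) (t : R) :
  geom_bounded a -> cvgn (pseries (fun k => a k / k`!%:R) t).
Proof.
move=> [b [s ha]].
apply: normed_cvg.
apply: (series_le_cvg (v_ := fun k => b * exp_coeff (`|s| * `|t|) k)).
- by move=> k; exact: normr_ge0.
- move=> k; rewrite /= mulr_ge0//.
    by have := ha 0%N; rewrite expr0 mulr1; apply: le_trans.
  by rewrite divr_ge0 ?ler0n// exprn_ge0 ?mulr_ge0.
- move=> k; rewrite /exp_coeff /= !normrM normfV (ger0_norm (ler0n _ _)).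
  rewrite exprMn normrX mulrAC [leRHS]mulrA ler_wpM2r ?invr_ge0 ?ler0n//.
  rewrite mulrA ler_wpM2r ?exprn_ge0// (le_trans (ha k))//.
  rewrite ler_wpM2l//; last by rewrite -normrX ler_norm.
  by have := ha 0%N; rewrite expr0 mulr1; apply: le_trans.
- rewrite (_ : series _ =
      fun N => b * series (exp_coeff (`|s| * `|t|)) N); last first.
    by apply/funext => N; rewrite /series /= mulr_sumr.
  apply: is_cvgM; [exact: is_cvg_cst | exact: is_cvg_series_exp_coeff].
Qed.

Lemma geom_bounded_shift (R : realType) (a : nat -> R) :
  geom_bounded a -> geom_bounded (fun k => a k.+1).
Proof.
by move=> [b [s ha]]; exists (b * s), s => k; rewrite -mulrA -exprS.
Qed.

Lemma egf_derive (R : realType) (a : nat -> R) (t : R) :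
  geom_bounded a -> is_derive t 1 (egf a) (egf (fun k => a k.+1) t).
Proof.
have diffE (c : nat -> R) : pseries_diffs (fun k => c k / k`!%:R) =
    (fun k => c k.+1 / k`!%:R).
  apply/funext => k; rewrite /pseries_diffs factS natrM invfM mulrCA.
  by rewrite mulVKf// pnatr_eq0.
move=> ha; rewrite /egf -(diffE a).
apply: (@pseries_snd_diffs _ _ (`|t| + 1));
  rewrite ?(diffE a) ?(diffE (fun k => a k.+1)).
- exact: egf_cvg.
- exact: egf_cvg (geom_bounded_shift ha).
- exact: egf_cvg (geom_bounded_shift (geom_bounded_shift ha)).
- by rewrite [ltRHS]ger0_norm ?addr_ge0// ltrDl.
Qed.

Lemma egf_sum (R : realType) (I : Type) (r : seq I) (c : I -> R)
    (a : I -> nat -> R) (t : R) : (forall i, geom_bounded (a i)) ->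
  \sum_(i <- r) c i * egf (a i) t =
  egf (fun k => \sum_(i <- r) c i * a i k) t.
Proof.
move=> ha; apply/esym/cvg_lim => //.
rewrite (_ : pseries _ t =
    fun N => \sum_(i <- r) c i * pseries (fun k => a i k / k`!%:R) t N).
  elim: r => [|i r IH].
    by under eq_fun do rewrite big_nil; rewrite big_nil; exact: cvg_cst.
  under eq_fun do rewrite big_cons; rewrite big_cons.
  by apply: cvgD => //; apply: cvgM; [exact: cvg_cst | exact: egf_cvg].
apply/funext => N; rewrite /pseries /series /=.
under [RHS]eq_bigr do rewrite mulr_sumr.
rewrite exchange_big /=; apply: eq_bigr => k _.
by rewrite !mulr_suml; apply: eq_bigr => i _; rewrite !mulrA.
Qed.

Lemma egf0 (R : realType) (a : nat -> R) : egf a 0 = a 0%N.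
Proof.
apply/cvg_lim => //; rewrite -(cvg_shiftn 1) /=.
rewrite (_ : (fun _ => _) = cst (a 0%N)); first exact: cvg_cst.
apply/funext => N; rewrite /pseries /series /= addn1 big_nat_recl//= big1 => [|k _].
  by rewrite divr1 mulr1 addr0.
by rewrite expr0n /= mulr0.
Qed.

(** Taking s to be the sum of the absolute values of all entries gives the
    bound s ^ k on the entries of the k-th power without an operator norm. *)
Lemma mx_pow_bounded (R : realType) (n : nat) (M : 'M[R]_n) :
  exists b s : R, forall k i j, `|(M ^+ k) i j| <= b * s ^+ k.
Proof.
exists 1, (\sum_i \sum_j `|M i j|) => k i j; rewrite mul1r.
elim: k i j => [|k IH] i j.
  by rewrite !expr0 [X in `|X|]mxE; case: (i == j); rewrite ?normr1 ?normr0.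
rewrite !exprS [X in `|X|]mxE (le_trans (ler_norm_sum _ _ _))//.
rewrite [leRHS]mulr_suml [leRHS](bigD1 i)//= -[leLHS]addr0 lerD//.
  rewrite mulr_suml ler_sum// => l _; rewrite normrM ler_wpM2l//.
rewrite sumr_ge0// => l _; rewrite mulr_ge0 ?sumr_ge0// exprn_ge0// sumr_ge0//.
by move=> ? _; rewrite sumr_ge0.
Qed.

Lemma mx_pow_geom_bounded (R : realType) (n : nat) (M : 'M[R]_n) (i j : 'I_n) :
  geom_bounded (fun k => (M ^+ k) i j).
Proof. by have [b [s hs]] := mx_pow_bounded M; exists b, s. Qed.

Lemma exprZmx (R : realType) (n : nat) (M : 'M[R]_n) (t : R) (k : nat) :
  (t *: M) ^+ k = t ^+ k *: M ^+ k.
Proof.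
elim: k => [|k IH]; first by rewrite !expr0 scale1r.
by rewrite !exprS IH -!mulmxE -scalemxAl -scalemxAr scalerA.
Qed.

Lemma expmx_entry (R : realType) (n : nat) (M : 'M[R]_n) (t : R) (i j : 'I_n) :
  expmx (t *: M) i j = egf (fun k => (M ^+ k) i j) t.
Proof.
suff -> : expmx (t *: M) = \matrix_(i, j) egf (fun k => (M ^+ k) i j) t.
  by rewrite mxE.
apply/cvg_lim; first exact: norm_hausdorff.
apply: cvg_mx_entry => {}i {}j; rewrite mxE.
rewrite (_ : (fun _ => _) = pseries (fun k => (M ^+ k) i j / k`!%:R) t).
  exact/egf_cvg/mx_pow_geom_bounded.
apply/funext => N; rewrite /pseries /series /= summxE; apply: eq_bigr => k _.
by rewrite exprZmx scalerA mxE mulrC mulrA.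
Qed.

Lemma mx_formE (R : realType) (n : nat) (N : 'M[R]_n)
    (r : 'rV[R]_n) (c : 'cV[R]_n) :
  (r *m N *m c) 0 0 =
  \sum_(p : 'I_n * 'I_n) (r 0 p.1 * c p.2 0) * N p.1 p.2.
Proof.
rewrite mxE -(pair_bigA _ (fun i j => r 0 i * c j 0 * N i j)) exchange_big /=.
apply: eq_bigr => j _; rewrite mxE mulr_suml; apply: eq_bigr => i _.
by rewrite mulrAC.
Qed.

(** All that is used of the exponential of a matrix are its scalar forms,
    and these are generating functions by linearity. *)
Lemma expmx_form (R : realType) (n : nat) (M : 'M[R]_n) (t : R)
    (r : 'rV[R]_n) (c : 'cV[R]_n) :
  (r *m expmx (t *: M) *m c) 0 0 = egf (fun k => (r *m M ^+ k *m c) 0 0) t.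
Proof.
under [in RHS]eq_fun do rewrite mx_formE.
rewrite mx_formE -egf_sum; last by move=> p; apply: mx_pow_geom_bounded.
by apply: eq_bigr => p _; rewrite expmx_entry.
Qed.

Lemma form_geom_bounded (R : realType) (n : nat) (M : 'M[R]_n)
    (r : 'rV[R]_n) (c : 'cV[R]_n) :
  geom_bounded (fun k => (r *m M ^+ k *m c) 0 0).
Proof.
have [a [s hs]] := mx_pow_bounded M; exists (\sum_(p : 'I_n * 'I_n)
  `|r 0 p.1 * c p.2 0| * a), s => k.
rewrite mx_formE (le_trans (ler_norm_sum _ _ _))// mulr_suml ler_sum// => p _.
by rewrite normrM -mulrA ler_wpM2l.
Qed.

Lemma expmx0 (R : realType) (n : nat) (M : 'M[R]_n) : expmx (0 *: M) = 1%:M.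
Proof. by apply/matrixP => i j; rewrite expmx_entry egf0 expr0. Qed.

(** Since M commutes with its powers, the derivative can be put on either
    side. The left form serves the lower bound, where row vectors are multiplied
    by powers of A; the right form serves the quadratic forms of Lyapunov. *)
Lemma expmx_derive_l (R : realType) (n : nat) (M : 'M[R]_n) (t : R)
    (r : 'rV[R]_n) (c : 'cV[R]_n) :
  is_derive t 1 (fun t => (r *m expmx (t *: M) *m c) 0 0)
    (((r *m M) *m expmx (t *: M) *m c) 0 0).
Proof.
rewrite (_ : (fun t => _) = egf (fun k => (r *m M ^+ k *m c) 0 0)); last first.
  by apply/funext => u; rewrite expmx_form.
rewrite expmx_form.
rewrite (_ : (fun k => (r *m M *m M ^+ k *m c) 0 0) =
    fun k => (r *m M ^+ k.+1 *m c) 0 0).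
  exact: (egf_derive _ (form_geom_bounded _ _ _)).
by apply/funext => k; rewrite exprS -mulmxE !mulmxA.
Qed.

Lemma expmx_derive_r (R : realType) (n : nat) (M : 'M[R]_n) (t : R)
    (r : 'rV[R]_n) (c : 'cV[R]_n) :
  is_derive t 1 (fun t => (r *m expmx (t *: M) *m c) 0 0)
    ((r *m expmx (t *: M) *m (M *m c)) 0 0).
Proof.
rewrite (_ : (fun t => _) = egf (fun k => (r *m M ^+ k *m c) 0 0)); last first.
  by apply/funext => u; rewrite expmx_form.
rewrite expmx_form.
rewrite (_ : (fun k => (r *m M ^+ k *m (M *m c)) 0 0) =
    fun k => (r *m M ^+ k.+1 *m c) 0 0).
  exact: (egf_derive _ (form_geom_bounded _ _ _)).
by apply/funext => k; rewrite exprSr -mulmxE !mulmxA.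
Qed.

(** * Exponential decay on the half-line *)

Lemma derive_le0_nonincreasing (R : realType) (f df : R -> R) (a b : R) :
  (forall t : R, is_derive t 1 f (df t)) -> (forall t : R, a <= t -> df t <= 0) ->
  a <= b -> f b <= f a.
Proof.
move=> hf hdf ab; have cf : {within `[a, b], continuous f}.
  by apply: derivable_within_continuous => x _; have := hf x; exact: @ex_derive.
have [c] := MVT_segment ab (fun x _ => hf x) cf.
rewrite in_itv /= => /andP[ac _] E.
by rewrite -subr_le0 E mulr_le0_ge0 ?hdf// subr_ge0.
Qed.

Lemma is_derive_expRM (R : realType) (k t : R) :
  is_derive t 1 (fun t : R => expR (k * t)) (k * expR (k * t)).
Proof.
rewrite (_ : (fun t => _) = expR \o (fun t : R => k * t))//.
have h : is_derive t 1 (fun t : R => k * t) k.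
  rewrite -[X in is_derive _ _ _ X]mulr1.
  exact: (@is_deriveZ _ _ _ id k t 1 1 (is_derive_id t 1)).
by have := @is_derive1_comp _ expR _ t _ _ (is_derive_expR _) h; rewrite mulrC.
Qed.

(** The function M / delta * exp (- delta t) - f is nonincreasing and its
    lower limit at infinity is nonnegative, so it is nonnegative. This is the
    integral of f' from t to infinity, estimated without integrals. *)
Lemma decay_le (R : realType) (f df : R -> R) (delta M C : R) : 0 < delta ->
  (forall t : R, is_derive t 1 f (df t)) ->
  (forall t : R, 0 <= t -> - df t <= M * expR (- delta * t)) ->
  (forall t : R, 0 <= t -> f t <= C * expR (- delta * t)) ->
  forall t : R, 0 <= t -> f t <= M / delta * expR (- delta * t).
Proof.
move=> d0 hf hdf hC t t0.
pose g (u : R) := M / delta * expR (- delta * u) - f u.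
pose dg (u : R) := M / delta * (- delta * expR (- delta * u)) - df u.
have hg (u : R) : is_derive u 1 g (dg u).
  apply: is_deriveB; exact: (@is_deriveZ _ _ _ (fun u : R => expR (- delta * u))
    (M / delta) u 1 _ (is_derive_expRM _ _)).
have dg0 (u : R) : t <= u -> dg u <= 0.
  move=> tu; have := hdf u (le_trans t0 tu); rewrite /dg.
  rewrite mulrA mulrN mulfVK ?gt_eqF// ; lra.
have gt (u : R) : t <= u -> g u <= g t.
  exact: (derive_le0_nonincreasing hg dg0).
rewrite -subr_ge0 -/(g t) leNgt; apply/negP => gt0.
have key (u : R) : t <= u -> - g t * (1 + delta * u) <= C - M / delta.
  move=> tu; have u0 := le_trans t0 tu.
  have e0 := expR_gt0 (delta * u); have e1 := expR_ge1Dx (delta * u).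
  have := hC u u0; have := gt u tu; rewrite {1}/g mulNr expRN => h1 h2.
  have h3 : - g t <= (C - M / delta) / expR (delta * u) by lra.
  move: h3; rewrite ler_pdivlMr// => h3; nra.
set D := C - M / delta in key.
have D0 : 0 <= D.
  apply: le_trans (key t (lexx t)).
  by rewrite mulr_ge0 ?addr_ge0 ?mulr_ge0 ?oppr_ge0 // ltW.
(* at this time the left-hand side of key exceeds D *)
have := key (t + D / (delta * - g t)).
have -> : - g t * (1 + delta * (t + D / (delta * - g t))) =
    - g t * (1 + delta * t) + D.
  by field; rewrite (gt_eqF d0) (lt_eqF gt0).
have : 0 <= D / (delta * - g t).
  by rewrite divr_ge0// mulr_ge0 ?oppr_ge0// ltW.
rewrite -(lerDl t) => hu /(_ hu).
rewrite gerDr leNgt mulr_gt0 ?oppr_gt0//.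
by rewrite ltr_pwDl// mulr_ge0// ltW.
Qed.

Lemma decay_norm (R : realType) (f df : R -> R) (delta M C : R) : 0 < delta ->
  (forall t : R, is_derive t 1 f (df t)) ->
  (forall t : R, 0 <= t -> `|df t| <= M * expR (- delta * t)) ->
  (forall t : R, 0 <= t -> `|f t| <= C * expR (- delta * t)) ->
  forall t : R, 0 <= t -> `|f t| <= M / delta * expR (- delta * t).
Proof.
move=> d0 hf hdf hC t t0; rewrite ler_norml lerNl; apply/andP; split.
- apply: (@decay_le _ (fun u : R => - f u) (fun u : R => - df u) _ _ C) => // u u0.
  + by rewrite opprK (le_trans (ler_norm _))// hdf.
  + by rewrite (le_trans (ler_norm _))// normrN hC.
- apply: (@decay_le _ f df _ _ C) => // u u0.
  + by rewrite (le_trans (ler_norm _))// normrN hdf.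
  + by rewrite (le_trans (ler_norm _))// hC.
Qed.

(** Each integration from infinity of a function that decays at rate delta
    gains a factor 1 / delta: this is where the power of delta in the lower
    bound comes from. *)
Lemma decay_iter (R : realType) (d : nat) (f : nat -> R -> R) (delta M : R) :
  0 < delta ->
  (forall i (t : R), (i < d)%N -> is_derive t 1 (f i) (f i.+1 t)) ->
  (forall i, exists C, forall t : R, 0 <= t -> `|f i t| <= C * expR (- delta * t)) ->
  (forall t : R, 0 <= t -> `|f d t| <= M * expR (- delta * t)) ->
  forall t : R, 0 <= t -> `|f 0%N t| <= M / delta ^+ d * expR (- delta * t).
Proof.
move=> d0; elim: d M => [|d IH] M hf hC hM; first by rewrite expr0 divr1.
rewrite exprS invfM mulrA; apply: IH => // [i t id|]; first exact/hf/ltnW.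
have [C hCd] := hC d.
by apply: (decay_norm (df := f d.+1) (C := C)) => // t; apply: hf.
Qed.

(** Lyapunov's argument for the rows of exp (t F): multiplied by
    exp (2 delta t), the quadratic form W is nonincreasing along r exp (t F).
    Working with rows puts W itself in the inequality, where the usual argument
    on columns needs its inverse. *)
Lemma lyapunov_decay (R : realType) (n : nat) (F W : 'M[R]_n) (delta : R) :
  (forall r : 'rV[R]_n, (r *m (F *m W + W *m F^T) *m r^T) 0 0 <=
    - (2 * delta) * (r *m W *m r^T) 0 0) ->
  forall (r : 'rV[R]_n) (t : R), 0 <= t ->
    (r *m expmx (t *: F) *m W *m (r *m expmx (t *: F))^T) 0 0 <=
    expR (- (2 * delta) * t) * (r *m W *m r^T) 0 0.
Proof.
move=> hW r t t0.
pose e j : 'cV[R]_n := delta_mx j 0.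
(* the quadratic form is a sum of products of two scalars each of which
   expmx_derive_r can differentiate *)
have formE (W' : 'M[R]_n) (x y : 'rV[R]_n) : (x *m W' *m y^T) 0 0 =
    \sum_(j < n) (x *m (W' *m (e j))) 0 0 * (y *m (e j)) 0 0.
  rewrite mxE; apply: eq_bigr => j _.
  by rewrite mulmxA /e -!colE ![col _ _ _ _]mxE ![_^T _ _]mxE.
pose x (u : R) := r *m expmx (u *: F).
pose V (u : R) := (x u *m W *m (x u)^T) 0 0.
pose dV (u : R) := (x u *m (F *m W + W *m F^T) *m (x u)^T) 0 0.
have hV (u : R) : is_derive u 1 V (dV u).
  rewrite (_ : V = \sum_(j < n) fun u : R => (x u *m (W *m (e j))) 0 0 *
      (x u *m (e j)) 0 0); last first.
    by apply/funext => v; rewrite fct_sumE /V formE.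
  rewrite (_ : dV u = \sum_(j < n) (
      (x u *m (W *m (e j))) 0 0 * (x u *m (F *m (e j))) 0 0 +
      (x u *m (e j)) 0 0 * (x u *m (F *m (W *m (e j)))) 0 0)).
    apply: is_derive_sum => j.
    by apply: is_deriveM; apply: expmx_derive_r.
  rewrite /dV mulmxDr mulmxDl mxE big_split addrC /=; congr (_ + _).
    rewrite (_ : _ *m _ *m _^T = x u *m W *m (x u *m F)^T).
      by rewrite formE; apply: eq_bigr => j _; rewrite -!mulmxA.
    by rewrite [in RHS]trmx_mul !mulmxA.
  rewrite (mulmxA _ F W) formE; apply: eq_bigr => j _.
  by rewrite mulrC -!mulmxA.
pose g (u : R) := expR (2 * delta * u) * V u.
have hg (u : R) : is_derive u 1 g (expR (2 * delta * u) * dV u +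
    V u * (2 * delta * expR (2 * delta * u))).
  exact: (is_deriveM (is_derive_expRM (2 * delta) u) (hV u)).
have /(_ t0) : 0 <= t -> g t <= g 0.
  apply: (derive_le0_nonincreasing hg) => u _.
  have := hW (x u); rewrite -/(dV u) -/(V u) => h.
  have := expR_gt0 (2 * delta * u); nra.
rewrite /g mulr0 expR0 mul1r mulNr expRN ler_pdivlMl ?expR_gt0//.
move=> /le_trans; apply.
by rewrite /V /x expmx0 mulmx1.
Qed.

(** * Euclidean norms and the stabilization prefactor *)

(** Squared Frobenius norm; on rows and columns, the squared Euclidean
    norm. It replaces the operator norm in all estimates where constants do not
    matter, and squares keep them polynomial. *)
Definition nsq (R : realType) (p q : nat) (M : 'M[R]_(p, q)) : R :=
  \sum_i \sum_j M i j ^+ 2.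

Lemma nsq_ge0 (R : realType) (p q : nat) (M : 'M[R]_(p, q)) : 0 <= nsq M.
Proof. by apply: sumr_ge0 => i _; apply: sumr_ge0 => j _; apply: sqr_ge0. Qed.

Lemma nsq_eq0 (R : realType) (p q : nat) (M : 'M[R]_(p, q)) :
  (nsq M == 0) = (M == 0).
Proof.
apply/idP/eqP => [|->]; last first.
  by rewrite /nsq big1// => i _; rewrite big1// => j _; rewrite mxE expr0n.
rewrite /nsq psumr_eq0; last by move=> i _; apply: sumr_ge0 => j _; apply: sqr_ge0.
move=> /allP h; apply/matrixP => i j; rewrite mxE; apply/eqP.
have := h i (mem_index_enum _); rewrite psumr_eq0; last by move=> ? _; apply: sqr_ge0.
by move=> /allP/(_ j (mem_index_enum _)); rewrite /= sqrf_eq0.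
Qed.

Lemma nsq0 (R : realType) (p q : nat) : nsq (0 : 'M[R]_(p, q)) = 0.
Proof. by apply/eqP; rewrite nsq_eq0. Qed.

Lemma nsqT (R : realType) (p q : nat) (M : 'M[R]_(p, q)) : nsq M^T = nsq M.
Proof.
rewrite /nsq exchange_big; apply: eq_bigr => i _.
by apply: eq_bigr => j _; rewrite mxE.
Qed.

Lemma nsqE (R : realType) (q : nat) (r : 'rV[R]_q) : nsq r = (r *m r^T) 0 0.
Proof.
by rewrite /nsq big_ord1 mxE; apply: eq_bigr => j _; rewrite mxE expr2.
Qed.

Lemma nsqZ (R : realType) (p q : nat) (a : R) (M : 'M[R]_(p, q)) :
  nsq (a *: M) = a ^+ 2 * nsq M.
Proof.
rewrite /nsq mulr_sumr; apply: eq_bigr => i _.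
by rewrite mulr_sumr; apply: eq_bigr => j _; rewrite mxE exprMn.
Qed.

Lemma nsqN (R : realType) (p q : nat) (M : 'M[R]_(p, q)) : nsq (- M) = nsq M.
Proof. by rewrite -scaleN1r nsqZ sqrrN expr1n mul1r. Qed.

Lemma nsqD (R : realType) (p q : nat) (M N : 'M[R]_(p, q)) :
  nsq (M + N) <= 2 * nsq M + 2 * nsq N.
Proof.
rewrite /nsq !mulr_sumr -big_split; apply: ler_sum => i _ /=.
rewrite !mulr_sumr -big_split; apply: ler_sum => j _ /=.
have sqD (a b : R) : (a + b) ^+ 2 <= 2 * a ^+ 2 + 2 * b ^+ 2.
  by rewrite -subr_ge0 (_ : _ - _ = (a - b) ^+ 2) ?sqr_ge0//; ring.
by rewrite mxE sqD.
Qed.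

(** Lagrange's identity. *)
Lemma cauchy_schwarz (R : realType) (n : nat) (a b : 'I_n -> R) :
  (\sum_i a i * b i) ^+ 2 <= (\sum_i a i ^+ 2) * (\sum_i b i ^+ 2).
Proof.
suff : 0 <= 2 * ((\sum_i a i ^+ 2) * (\sum_i b i ^+ 2)) -
    2 * (\sum_i a i * b i) ^+ 2 by lra.
have -> : 2 * ((\sum_i a i ^+ 2) * (\sum_i b i ^+ 2)) -
    2 * (\sum_i a i * b i) ^+ 2 =
    \sum_i \sum_j (a i * b j - a j * b i) ^+ 2.
  transitivity (\sum_i \sum_j (a i ^+ 2 * b j ^+ 2)
      + \sum_i \sum_j (a j ^+ 2 * b i ^+ 2)
      - 2 * \sum_i \sum_j (a i * b i) * (a j * b j)).
    rewrite [X in _ + X - _]exchange_big /=.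
    by rewrite -!big_distrlr /= expr2; ring.
  rewrite mulr_sumr -big_split -sumrB; apply: eq_bigr => i _ /=.
  rewrite mulr_sumr -big_split -sumrB; apply: eq_bigr => j _ /=.
  ring.
by apply: sumr_ge0 => i _; apply: sumr_ge0 => j _; apply: sqr_ge0.
Qed.

Lemma nsqM (R : realType) (p q s : nat) (M : 'M[R]_(p, q)) (N : 'M[R]_(q, s)) :
  nsq (M *m N) <= nsq M * nsq N.
Proof.
rewrite /nsq mulr_suml; apply: ler_sum => i _.
rewrite [in leRHS]exchange_big mulr_sumr; apply: ler_sum => j _.
by rewrite mxE; exact: cauchy_schwarz.
Qed.

Lemma nsqX (R : realType) (p n k : nat) (y : 'M[R]_(p, n)) (M : 'M[R]_n) :
  nsq (y *m M ^+ k) <= nsq M ^+ k * nsq y.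
Proof.
elim: k => [|k IH]; first by rewrite !expr0 mulmx1 mul1r.
rewrite exprSr -mulmxE mulmxA (le_trans (nsqM _ _))// mulrC exprS -mulrA.
by rewrite ler_wpM2l ?nsq_ge0.
Qed.

(** A matrix and its transpose have the same operator norm: |y|^2 is the
    product of the row y^T E with x when y = E x. *)
Lemma nsq_mul_col (R : realType) (n : nat) (E : 'M[R]_n) (c : R) :
  0 <= c -> (forall r : 'rV[R]_n, nsq (r *m E) <= c * nsq r) ->
  forall x : 'cV[R]_n, nsq (E *m x) <= c * nsq x.
Proof.
move=> c0 hE x; set y := E *m x.
have [->|y0] := eqVneq (nsq y) 0; first by rewrite mulr_ge0 ?nsq_ge0.
have y_gt0 : 0 < nsq y by rewrite lt_neqAle eq_sym y0 nsq_ge0.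
have : nsq y ^+ 2 <= c * nsq y * nsq x.
  rewrite -(nsqT y); apply: (@le_trans _ _ (nsq (y^T *m E) * nsq x)).
    rewrite {1}nsqE trmxK /y mulmxA -/y.
    apply: le_trans (nsqM _ _).
    by rewrite /nsq !big_ord1.
  by rewrite ler_wpM2r ?nsq_ge0.
by rewrite expr2 mulrAC ler_pM2r.
Qed.

Lemma enormE (R : realType) (n : nat) (x : 'cV[R]_n) :
  enorm x = Num.sqrt (nsq x).
Proof.
by rewrite /enorm /nsq; congr Num.sqrt; apply: eq_bigr => i _; rewrite big_ord1.
Qed.

Lemma opnorm_le (R : realType) (n : nat) (M : 'M[R]_n) (c : R) : 0 <= c ->
  (forall x : 'cV[R]_n, nsq (M *m x) <= c ^+ 2 * nsq x) -> opnorm M <= c.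
Proof.
move=> c0 h; apply: ge_sup.
  exists (enorm (M *m 0)), 0 => //=.
  by rewrite enormE nsq0 sqrtr0.
move=> _ [x /= x1 <-]; rewrite !enormE in x1 *.
rewrite -(sqrtr1 R) ler_sqrt// in x1.
rewrite -(ger0_norm c0) -sqrtr_sqr ler_wsqrtr// (le_trans (h x))//.
by rewrite -[leRHS]mulr1 ler_wpM2l// sqr_ge0.
Qed.

Lemma le_opnorm (R : realType) (n : nat) (M : 'M[R]_n) (x : 'cV[R]_n) :
  Num.sqrt (nsq (M *m x)) <= opnorm M * Num.sqrt (nsq x).
Proof.
have [->|x0] := eqVneq x 0.
  by rewrite mulmx0 nsq0 sqrtr0 mulr0.
have s0 : 0 < Num.sqrt (nsq x).
  by rewrite sqrtr_gt0 lt_neqAle nsq_ge0 andbT eq_sym nsq_eq0.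
rewrite -ler_pdivrMr//; apply: ub_le_sup.
  exists (Num.sqrt (nsq M)) => _ [z /= z1 <-]; rewrite !enormE in z1 *.
  rewrite -(sqrtr1 R) ler_sqrt// in z1.
  by rewrite ler_wsqrtr// (le_trans (nsqM _ _))// -[leRHS]mulr1 ler_wpM2l ?nsq_ge0.
have i0 : 0 <= (Num.sqrt (nsq x))^-1 by rewrite invr_ge0 ltW.
exists ((Num.sqrt (nsq x))^-1 *: x) => /=; rewrite enormE.
  by rewrite nsqZ sqrtrM ?sqr_ge0// sqrtr_sqr ger0_norm// mulVf// gt_eqF.
by rewrite -scalemxAr nsqZ sqrtrM ?sqr_ge0// sqrtr_sqr ger0_norm// mulrC.
Qed.

Lemma stab_prefactor_le (R : realType) (n m : nat) (A : 'M[R]_n)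
    (B : 'M[R]_(n, m)) (K : 'M[R]_(m, n)) (delta c : R) : 0 <= c ->
  (forall (r : 'rV[R]_n) (t : R), 0 <= t ->
    nsq (r *m expmx (t *: (A + B *m K))) <=
      c ^+ 2 * expR (- (2 * delta) * t) * nsq r) ->
  (stab_prefactor A B delta <= c%:E)%E.
Proof.
move=> c0 h; apply: (@le_trans _ _ (ereal_sup
      [set (expR (delta * t) * opnorm (expmx (t *: (A + B *m K))))%:E
        | t in [set t : R | 0 <= t]])).
  by apply: ereal_inf_lbound; exists K.
apply: ge_ereal_sup => _ [t /= t0 <-]; rewrite lee_fin.
rewrite mulrC -ler_pdivlMr ?expR_gt0//.
apply: opnorm_le; first by rewrite divr_ge0// expR_ge0.
apply: nsq_mul_col => [|r]; first exact: sqr_ge0.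
apply: le_trans (h r t t0) _.
rewrite le_eqVlt; apply/orP; left; apply/eqP; congr (_ * _).
rewrite exprMn -expRN -expRM_natl; congr (_ * expR _); ring.
Qed.

(** If the supremum over time is infinite there is nothing to prove, so
    only a real bound C on the weighted norms has to be considered. *)
Lemma stab_prefactor_ge (R : realType) (n m : nat) (A : 'M[R]_n)
    (B : 'M[R]_(n, m)) (delta c : R) :
  (forall (K : 'M[R]_(m, n)) (C : R),
    (forall t : R, 0 <= t ->
       expR (delta * t) * opnorm (expmx (t *: (A + B *m K))) <= C) -> c <= C) ->
  (c%:E <= stab_prefactor A B delta)%E.
Proof.
move=> h; apply: le_ereal_inf_tmp => _ [K _ <-].
set S := ereal_sup _.
have hS (t : R) : 0 <= t ->
    ((expR (delta * t) * opnorm (expmx (t *: (A + B *m K))))%:E <= S)%E.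
  by move=> t0; apply: ereal_sup_ubound; exists t.
case: S hS => [C hC|_|hC].
- by rewrite lee_fin; apply: (h K) => t t0; rewrite -lee_fin hC.
- by rewrite leey.
- by have := hC 0 (lexx 0); rewrite leNgt ltNye.
Qed.

Lemma stab_prefactor_ge1 (R : realType) (n m : nat) (A : 'M[R]_n)
    (B : 'M[R]_(n, m)) (delta : R) : (0 < n)%N ->
  (1%:E <= stab_prefactor A B delta)%E.
Proof.
move=> n0; apply: stab_prefactor_ge => K C /(_ 0 (lexx 0)); apply: le_trans.
rewrite mulr0 expR0 mul1r expmx0.
have := le_opnorm 1%:M (delta_mx (Ordinal n0) 0 : 'cV[R]_n).
rewrite mul1mx ler_pMl// sqrtr_gt0 lt_neqAle nsq_ge0 andbT eq_sym nsq_eq0.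
apply/eqP => /matrixP/(_ (Ordinal n0) 0); rewrite !mxE !eqxx => /eqP.
by rewrite oner_eq0.
Qed.

(** * The lower bound *)

(** Before the rank is full, some direction is not reached by the columns
    of the controllability matrix. *)
Lemma exists_annihilator (R : realType) (n m : nat) (A : 'M[R]_n)
    (B : 'M[R]_(n, m)) (d : nat) : (\rank (ctrbmx A B d) != n)%N ->
  exists2 q : 'rV[R]_n, q != 0 & forall i, (i < d)%N -> q *m A ^+ i *m B = 0.
Proof.
move=> rk; have : kermx (ctrbmx A B d) != 0.
  by apply: contraNneq rk => /eqP; rewrite kermx_eq0.
move=> /rowV0Pn[q /sub_kermxP qC q0]; exists q => // i id.
move: qC; rewrite /ctrbmx mul_mxrow -mxrow0 => /eq_mxrowP/(_ (Ordinal id)) /=.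
by rewrite mulmxA.
Qed.

(** Feedback cannot be seen through q until d derivatives have been taken,
    whatever the gain K is. *)
Lemma mul_feedback_pow (R : realType) (n m : nat) (A : 'M[R]_n)
    (B : 'M[R]_(n, m)) (K : 'M[R]_(m, n)) (d : nat) (q : 'rV[R]_n) :
  (forall i, (i < d)%N -> q *m A ^+ i *m B = 0) ->
  forall i, (i <= d)%N -> q *m (A + B *m K) ^+ i = q *m A ^+ i.
Proof.
move=> hq; elim=> [|i IH] id; first by rewrite !expr0.
rewrite !exprSr -!mulmxE !mulmxA (IH (ltnW id)) mulmxDr [_ *m (B *m K)]mulmxA.
by rewrite hq// mul0mx addr0.
Qed.

Lemma norm_form_le (R : realType) (n : nat) (r : 'rV[R]_n) (c : 'cV[R]_n) :
  `|(r *m c) 0 0| <= Num.sqrt (nsq r) * Num.sqrt (nsq c).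
Proof.
rewrite -sqrtr_sqr -sqrtrM ?nsq_ge0// ler_wsqrtr//.
by apply: le_trans (nsqM _ _); rewrite {1}/nsq !big_ord1.
Qed.

(** The function q exp (t F) q^T is |q|^2 at time 0; its derivatives up to
    order d are q A^i exp (t F) q^T, and all decay at rate delta. Integrating
    the last one d times from infinity bounds |q|^2 by a multiple of C / delta^d. *)
Lemma decay_rate_lower (R : realType) (n m : nat) (A : 'M[R]_n)
    (B : 'M[R]_(n, m)) (K : 'M[R]_(m, n)) (d : nat) (q : 'rV[R]_n)
    (delta C : R) :
  (forall i, (i < d)%N -> q *m A ^+ i *m B = 0) -> 0 < delta ->
  (forall t : R, 0 <= t ->
     expR (delta * t) * opnorm (expmx (t *: (A + B *m K))) <= C) ->
  nsq q <= Num.sqrt (nsq (q *m A ^+ d)) * Num.sqrt (nsq q) * C / delta ^+ d.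
Proof.
move=> hq d0 hC; set F := A + B *m K.
pose f i (t : R) := (q *m A ^+ i *m expmx (t *: F) *m q^T) 0 0.
have hf i (t : R) : (i < d)%N -> is_derive t 1 (f i) (f i.+1 t).
  move=> id; rewrite /f -[q *m A ^+ i.+1](mul_feedback_pow K hq id).
  rewrite exprSr -mulmxE mulmxA (mul_feedback_pow K hq (ltnW id)).
  exact: expmx_derive_l.
have fC i (t : R) : 0 <= t -> `|f i t| <=
    Num.sqrt (nsq (q *m A ^+ i)) * Num.sqrt (nsq q) * C * expR (- delta * t).
  move=> t0; rewrite /f -mulmxA (le_trans (norm_form_le _ _))// -!mulrA.
  rewrite ler_wpM2l ?sqrtr_ge0// (le_trans (le_opnorm _ _))// nsqT mulrC.
  rewrite ler_wpM2l ?sqrtr_ge0// mulNr expRN ler_pdivlMr ?expR_gt0// mulrC.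
  exact: hC.
have := decay_iter d0 hf (fun i => ex_intro _ _ (fC i)) (fC d) (lexx 0).
rewrite mulr0 expR0 mulr1 /f expmx0 expr0 !mulmx1 -nsqE.
by apply: le_trans; exact: ler_norm.
Qed.

Lemma stab_prefactor_lower (R : realType) (n m : nat) (A : 'M[R]_n)
    (B : 'M[R]_(n, m)) (d : nat) : (\rank (ctrbmx A B d) != n)%N ->
  exists2 c : R, 0 < c & forall delta : R, 0 < delta ->
    ((c * delta ^+ d)%:E <= stab_prefactor A B delta)%E.
Proof.
move=> /exists_annihilator[q q0 hq].
pose N := Num.sqrt (nsq (q *m A ^+ d)) * Num.sqrt (nsq q).
have N0 : 0 <= N by rewrite mulr_ge0 ?sqrtr_ge0.
have nq : 0 < nsq q by rewrite lt_neqAle nsq_ge0 andbT eq_sym nsq_eq0.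
(* the added 1 spares a proof that q A^d is not 0 *)
exists (nsq q / (N + 1)); first by rewrite divr_gt0// ltr_wpDl.
move=> delta d0; apply: stab_prefactor_ge => K C hC.
have := decay_rate_lower hq d0 hC; rewrite -/N ler_pdivlMr ?exprn_gt0// => h.
have nd : 0 < nsq q * delta ^+ d by rewrite mulr_gt0 ?exprn_gt0.
have C0 : 0 < C by rewrite ltNge; apply/negP => C0; nra.
rewrite mulrAC ler_pdivrMr ?ltr_wpDl//; nra.
Qed.

(** * The upper bound *)

Lemma unitmx_inj (R : realType) (n : nat) (M : 'M[R]_n) :
  (forall z : 'rV[R]_n, z *m M = 0 -> z = 0) -> M \in unitmx.
Proof.
move=> h; rewrite -row_free_unit -kermx_eq0; apply/rowV0P => z zM.
exact/h/sub_kermxP.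
Qed.

(** A right inverse X of the controllability matrix recovers y from the
    products y A^i B. *)
Lemma controllable_coercive (R : realType) (n m : nat) (A : 'M[R]_n)
    (B : 'M[R]_(n, m)) (j : nat) : (\rank (ctrbmx A B j) == n)%N ->
  exists2 c : R, 0 <= c & forall y : 'rV[R]_n,
    nsq y <= c * \sum_(i < j) nsq (y *m A ^+ i *m B).
Proof.
move=> rk; have /row_freeP[X CX] : row_free (ctrbmx A B j) by [].
exists (nsq X); first exact: nsq_ge0.
move=> y; rewrite -{1}[y]mulmx1 -CX mulmxA mulrC (le_trans (nsqM _ _))//.
rewrite ler_wpM2r ?nsq_ge0// nsqE /ctrbmx mul_mxrow tr_mxrow mul_mxrow_mxcol.
by rewrite summxE ler_sum// => i _; rewrite nsqE mulmxA.
Qed.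

(** The gain K = - B^T W^-1 / (4 delta) of Bass subtracts B B^T / (2 delta)
    from A W + W A^T; what remains is - 2 delta W and a negative term. *)
Lemma bass_feedback_decay (R : realType) (n m p : nat) (A : 'M[R]_n)
    (B : 'M[R]_(n, m)) (W : 'M[R]_n) (G : 'M[R]_(n, p)) (delta : R) :
  0 < delta -> W^T = W -> W \in unitmx ->
  (2 * delta) *: (A *m W + W *m A^T + (2 * delta) *: W) =
    B *m B^T - G *m G^T ->
  exists K : 'M[R]_(m, n), forall (r : 'rV[R]_n) (t : R), 0 <= t ->
    let E := expmx (t *: (A + B *m K)) in
    (r *m E *m W *m (r *m E)^T) 0 0 <=
    expR (- (2 * delta) * t) * (r *m W *m r^T) 0 0.
Proof.
move=> d0 Wsym Wu hW; pose g := (2 * delta)^-1.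
have g2 : g * (2 * delta) = 1 by rewrite mulVf// gt_eqF// mulr_gt0.
exists (- (g / 2) *: (B^T *m invmx W)); apply: lyapunov_decay => r.
rewrite (_ : _ + _ = - (2 * delta) *: W - g *: (G *m G^T)).
  rewrite mulmxBr mulmxBl [X in X <= _]mxE -!scalemxAr -!scalemxAl.
  rewrite [X in X + _ <= _]mxE [X in _ + X <= _]mxE [X in _ - X <= _]mxE.
  rewrite gerDl oppr_le0 mulr_ge0 ?invr_ge0 ?mulr_ge0 ?(ltW d0)//.
  by have := nsq_ge0 (r *m G); rewrite nsqE trmx_mul !mulmxA.
have -> : (A + B *m (- (g / 2) *: (B^T *m invmx W))) *m W =
    A *m W - (g / 2) *: (B *m B^T).
  by rewrite mulmxDl -scalemxAr -scalemxAl !mulmxA mulmxKV// scaleNr.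
have -> : W *m (A + B *m (- (g / 2) *: (B^T *m invmx W)))^T =
    W *m A^T - (g / 2) *: (B *m B^T).
  rewrite -{1}Wsym -trmx_mul mulmxDl -scalemxAr -scalemxAl !mulmxA mulmxKV//.
  by rewrite linearD linearZ /= !trmx_mul trmxK Wsym scaleNr.
move: (A *m W) (W *m A^T) (B *m B^T) (G *m G^T) hW => X Y P Q hW.
apply/matrixP => i j; move/matrixP/(_ i j): hW; rewrite !mxE => hW.
have {}hW : X i j + Y i j + 2 * delta * W i j = g * (P i j - Q i j).
  by rewrite -hW mulrA g2 mul1r.
lra.
Qed.

(** When |A| <= delta, the matrix A + 2 delta multiplies the length of a row
    by a factor between delta and a fixed multiple of delta. *)
Lemma resolvent_exists (R : realType) (n : nat) (A : 'M[R]_n) (delta : R) :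
  0 < delta -> nsq A <= delta ^+ 2 ->
  exists N : 'M[R]_n, [/\ A *m N = N *m A,
    (2 * delta) *: N + A *m N = 1%:M,
    forall r : 'rV[R]_n, nsq (r *m N) <= delta ^- 2 * nsq r &
    forall r : 'rV[R]_n, nsq r <= 10 * delta ^+ 2 * nsq (r *m N)].
Proof.
move=> d0 hA; pose M := A + (2 * delta)%:M.
have zME p (z : 'M[R]_(p, n)) : z *m M = z *m A + (2 * delta) *: z.
  by rewrite mulmxDr mul_mx_scalar.
have zA p (z : 'M[R]_(p, n)) : nsq (z *m A) <= delta ^+ 2 * nsq z.
  by rewrite (le_trans (nsqM _ _))// mulrC ler_wpM2r ?nsq_ge0.
have lo p (z : 'M[R]_(p, n)) : delta ^+ 2 * nsq z <= nsq (z *m M).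
  have := nsqD (z *m M) (- (z *m A)).
  rewrite {1}zME addrC addKr nsqN nsqZ; have := zA _ z; nra.
have up p (z : 'M[R]_(p, n)) : nsq (z *m M) <= 10 * delta ^+ 2 * nsq z.
  have := nsqD (z *m A) ((2 * delta) *: z).
  rewrite -zME nsqZ; have := zA _ z; nra.
have Mu : M \in unitmx.
  apply: unitmx_inj => z zM; apply/eqP; rewrite -nsq_eq0.
  have := lo _ z; rewrite zM nsq0 => h.
  by rewrite eq_le nsq_ge0 andbT -(pmulr_rle0 _ (exprn_gt0 2 d0)).
have NM (r : 'rV[R]_n) : r *m invmx M *m M = r by rewrite mulmxKV.
exists (invmx M); split.
- have MA : M *m A = A *m M by rewrite mulmxDr mulmxDl scalar_mxC.
  by rewrite -[in LHS](mulKmx Mu A) MA !mulmxA mulmxK.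
- by rewrite addrC -mul_scalar_mx -mulmxDl mulmxV.
- move=> r; rewrite mulrC ler_pdivlMr ?exprn_gt0// mulrC.
  by have := lo _ (r *m invmx M); rewrite NM.
- by move=> r; have := up _ (r *m invmx M); rewrite NM.
Qed.

(** With N the inverse of A + 2 delta, these are the terms U^k N B of a
    geometric series, where U = A N is the Cayley transform of A + delta. *)
Definition gram_factor (R : realType) (n m : nat) (A N : 'M[R]_n)
    (B : 'M[R]_(n, m)) (k : nat) : 'M[R]_(n, m) :=
  A ^+ k *m N ^+ k.+1 *m B.

(** The controllability Gramian of the pair (U, N B) over the steps 0 to d. The
    infinite sum would solve the Lyapunov equation of A + delta exactly; cut at
    d it solves it up to a term of favourable sign, and the summands kept are
    just enough to make it positive definite. *)
Definition shifted_gramian (R : realType) (n m d : nat) (A N : 'M[R]_n)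
    (B : 'M[R]_(n, m)) : 'M[R]_n :=
  \sum_(k < d.+1) gram_factor A N B k *m (gram_factor A N B k)^T.

Lemma shifted_gramian_sym (R : realType) (n m d : nat) (A N : 'M[R]_n)
    (B : 'M[R]_(n, m)) :
  (shifted_gramian d A N B)^T = shifted_gramian d A N B.
Proof.
rewrite /shifted_gramian linear_sum; apply: eq_bigr => k _ /=.
by rewrite trmx_mul trmxK.
Qed.

Lemma shifted_gramianE (R : realType) (n m d : nat) (A N : 'M[R]_n)
    (B : 'M[R]_(n, m)) (r : 'rV[R]_n) :
  (r *m shifted_gramian d A N B *m r^T) 0 0 =
  \sum_(k < d.+1) nsq (r *m gram_factor A N B k).
Proof.
rewrite mulmx_sumr mulmx_suml summxE; apply: eq_bigr => k _.
by rewrite nsqE; move: (gram_factor A N B k) => X; rewrite trmx_mul !mulmxA.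
Qed.

(** With M = A + 2 delta, the left-hand side is M W M^T - A W A^T. Multiplying
    the k-th factor of W by M gives L_k = A^k N^k B and multiplying it by A gives
    L_(k+1), so the difference telescopes. *)
Lemma shifted_gramian_lyapunov (R : realType) (n m d : nat) (A N : 'M[R]_n)
    (B : 'M[R]_(n, m)) (delta : R) :
  (2 * delta) *: N + A *m N = 1%:M ->
  let W := shifted_gramian d A N B in
  let L := A ^+ d.+1 *m N ^+ d.+1 *m B in
  (2 * delta) *: (A *m W + W *m A^T + (2 * delta) *: W) =
  B *m B^T - L *m L^T.
Proof.
move=> N1; pose G := gram_factor A N B.
pose L k := A ^+ k *m N ^+ k *m B; rewrite /= -/(L d.+1).
have AG k : A *m G k = L k.+1.
  by rewrite /G /gram_factor /L [A ^+ k.+1]exprS -mulmxE !mulmxA.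
have MG k : A *m G k + (2 * delta) *: G k = L k.
  rewrite AG /L /G /gram_factor [A ^+ _]exprSr [N ^+ _]exprS -!mulmxE !mulmxA.
  rewrite scalemxAl -mulmxDl; congr (_ *m _).
  rewrite scalemxAl -mulmxDl; congr (_ *m _).
  by rewrite scalemxAr -[A ^+ k *m A *m N]mulmxA -mulmxDr addrC N1 mulmx1.
have step (X : 'M[R]_(n, m)) :
    (2 * delta) *: (A *m (X *m X^T) + X *m X^T *m A^T + (2 * delta) *: (X *m X^T)) =
    (A *m X + (2 * delta) *: X) *m (A *m X + (2 * delta) *: X)^T -
    (A *m X) *m (A *m X)^T.
  rewrite mulmxA -[X *m X^T *m A^T]mulmxA -trmx_mul.
  move: (A *m X) => Y; 
  have -> : (Y + (2 * delta) *: X)^T = Y^T + (2 * delta) *: X^T.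
    by apply/matrixP => i j; rewrite !mxE.
  rewrite mulmxDl !mulmxDr.
  rewrite -!scalemxAl -!scalemxAr.
  move: (Y *m X^T) (X *m Y^T) (X *m X^T) (Y *m Y^T) => P1 P2 P3 P4.
  by apply/matrixP => i j; rewrite !mxE; ring.
rewrite /shifted_gramian -/G mulmx_sumr mulmx_suml scaler_sumr -!big_split /=.
rewrite scaler_sumr; under eq_bigr => k _ do rewrite step MG AG -opprB.
rewrite -(big_mkord xpredT (fun k => - (L k.+1 *m (L k.+1)^T - L k *m (L k)^T))).
by rewrite sumrN telescope_sumr// opprB /L !expr0 !mul1mx.
Qed.

(** The quadratic form contains the squares with i = 0. The others come from
    2 delta N = 1 - A N, which writes the vector with indices (i + 1, j) as
    1 / (2 delta) times the difference of those with (i, j) and (i, j + 1). *)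
Lemma shifted_gramian_dominates (R : realType) (n m d : nat) (A N : 'M[R]_n)
    (B : 'M[R]_(n, m)) (delta : R)
    (r : 'rV[R]_n) (i j : nat) :
  (2 * delta) *: N + A *m N = 1%:M -> 1 <= delta -> (i + j <= d)%N ->
  nsq (r *m (A ^+ j *m N ^+ (i + j).+1 *m B)) <=
    (r *m shifted_gramian d A N B *m r^T) 0 0.
Proof.
rewrite shifted_gramianE => N1 d1; elim: i j => [|i IH] j ijd.
  have jd : (j < d.+1)%N by rewrite ltnS.
  rewrite (bigD1 (Ordinal jd)) //= lerDl sumr_ge0// => k _; exact: nsq_ge0.
set V := \sum_(k < _) _ in IH *.
have E : (2 * delta) *: (r *m (A ^+ j *m N ^+ (i.+1 + j).+1 *m B)) =
   r *m (A ^+ j *m N ^+ (i + j).+1 *m B) -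
   r *m (A ^+ j.+1 *m N ^+ (i + j.+1).+1 *m B).
  rewrite -mulmxBr -mulmxBl scalemxAr scalemxAl; congr (_ *m (_ *m _)).
  rewrite addSn addnS [A ^+ j.+1]exprSr [N ^+ (i + j).+2]exprS -!mulmxE.
  rewrite -[A ^+ j *m A *m _]mulmxA scalemxAr -mulmxBr; congr (_ *m _).
  apply/eqP; rewrite eq_sym subr_eq mulmxA scalemxAl -mulmxDl N1.
  by rewrite mul1mx.
have := nsqD (r *m (A ^+ j *m N ^+ (i + j).+1 *m B))
  (- (r *m (A ^+ j.+1 *m N ^+ (i + j.+1).+1 *m B))).
rewrite -E nsqZ nsqN.
have := IH j (ltnW ijd); have := IH j.+1; rewrite addnS => /(_ ijd).
set x := nsq (r *m (A ^+ j *m N ^+ (i.+1 + j).+1 *m B)).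
have : 4 * x <= (2 * delta) ^+ 2 * x.
  by rewrite ler_wpM2r ?nsq_ge0//; nra.
lra.
Qed.


Lemma nsq_mul_iter (R : realType) (n : nat) (N : 'M[R]_n) (a : R) (k : nat) :
  0 <= a -> (forall r : 'rV[R]_n, nsq (r *m N) <= a * nsq r) ->
  forall r : 'rV[R]_n, nsq (r *m N ^+ k) <= a ^+ k * nsq r.
Proof.
move=> a0 hN r; elim: k => [|k IH]; first by rewrite !expr0 mulmx1 mul1r.
rewrite exprSr -mulmxE mulmxA (le_trans (hN _))// exprS -mulrA.
by rewrite ler_wpM2l.
Qed.

Lemma nsq_mul_iter_ge (R : realType) (n : nat) (N : 'M[R]_n) (a : R) (k : nat) :
  0 <= a -> (forall r : 'rV[R]_n, nsq r <= a * nsq (r *m N)) ->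
  forall r : 'rV[R]_n, nsq r <= a ^+ k * nsq (r *m N ^+ k).
Proof.
move=> a0 hN r; elim: k => [|k IH]; first by rewrite !expr0 mulmx1 mul1r.
apply: le_trans IH _; rewrite [N ^+ k.+1]exprSr -mulmxE mulmxA [a ^+ k.+1]exprSr -mulrA.
by rewrite ler_wpM2l// exprn_ge0.
Qed.

(** The smallest eigenvalue of the Gramian is at least of order
    delta^(-2(d+1)) and the largest at most of order delta^-2. The square root of
    their ratio is of order delta^d, and it bounds the prefactor of the closed
    loop for which the Gramian is a Lyapunov function. *)
Lemma stab_prefactor_upper (R : realType) (n m : nat) (A : 'M[R]_n)
    (B : 'M[R]_(n, m)) (d : nat) : (\rank (ctrbmx A B d.+1) == n)%N ->
  exists2 c : R, 0 < c & forall delta : R, 1 <= delta -> nsq A <= delta ^+ 2 ->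
    (stab_prefactor A B delta <= (c * delta ^+ d)%:E)%E.
Proof.
move=> /controllable_coercive[kappa kappa0 hkappa].
pose b := 10 ^+ d.+1 * kappa * d.+1%:R ^+ 2 * nsq B.
have b0 : 0 <= b by rewrite !mulr_ge0 ?exprn_ge0 ?nsq_ge0 ?ler0n.
exists (Num.sqrt b + 1); first by rewrite ltr_wpDl ?sqrtr_ge0.
move=> delta d1 hA; have d0 : 0 < delta by exact: lt_le_trans ltr01 d1.
have [N [AN N1 Nup Nlo]] := resolvent_exists d0 hA.
pose W := shifted_gramian d A N B.
pose V (r : 'rV[R]_n) := (r *m W *m r^T) 0 0.
have NAX (i j : nat) : N ^+ i *m A ^+ j = A ^+ j *m N ^+ i.
  by rewrite !mulmxE; apply/commrX/commr_sym/commrX.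
(* r = y (A + 2 delta)^(d+1) with y = r N^(d+1), and the products y A^i B,
   i <= d, determine y and are controlled by V *)
have Vlo r : nsq r <= 10 ^+ d.+1 * kappa * d.+1%:R * delta ^+ (2 * d.+1) * V r.
  have h : nsq (r *m N ^+ d.+1) <= kappa * (d.+1%:R * V r).
    rewrite (le_trans (hkappa _))// ler_wpM2l//.
    apply: (@le_trans _ _ (\sum_(i < d.+1) V r)); last first.
      by rewrite sumr_const card_ord mulr_natl.
    apply: ler_sum => i _; have id : (i <= d)%N by rewrite -ltnS.
    rewrite -[r *m _ *m _]mulmxA NAX.
    have ijd : (d - i + i <= d)%N by rewrite subnK.
    have := shifted_gramian_dominates B r N1 d1 ijd; rewrite subnK//.
    by rewrite !mulmxA.
  have a0 : 0 <= 10 * delta ^+ 2 by rewrite mulr_ge0// sqr_ge0.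
  apply: le_trans (nsq_mul_iter_ge d.+1 a0 Nlo r) _.
  apply: (le_trans (ler_wpM2l (exprn_ge0 _ a0) h)).
  rewrite exprMn -exprM le_eqVlt; apply/orP; left; apply/eqP; ring.
(* each of the k + 1 factors N gains 1 / delta and each of the k factors A
   loses at most delta *)
have Vup r : V r <= d.+1%:R * nsq B * delta ^- 2 * nsq r.
  have sumE (a : R) : \sum_(k < d.+1) a = d.+1%:R * a.
    by rewrite sumr_const card_ord mulr_natl.
  rewrite /V shifted_gramianE -!mulrA -sumE; apply: ler_sum => k _.
  rewrite !mulmxA (le_trans (nsqM _ _))// mulrC ler_wpM2l ?nsq_ge0//.
  have i0 : 0 <= delta ^- 2 by rewrite invr_ge0 sqr_ge0.
  apply: le_trans (nsq_mul_iter k.+1 i0 Nup _) _.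
  rewrite exprS -mulrA ler_wpM2l//.
  apply: (@le_trans _ _ (delta ^- 2 ^+ k * ((delta ^+ 2) ^+ k * nsq r))).
    rewrite ler_wpM2l ?exprn_ge0//; apply: nsq_mul_iter; first exact: sqr_ge0.
    by move=> z; rewrite (le_trans (nsqM _ _))// mulrC ler_wpM2r ?nsq_ge0.
  by rewrite mulrA -exprMn mulVf ?expr1n ?mul1r// expf_neq0// gt_eqF.
have Wu : W \in unitmx.
  apply: unitmx_inj => z zW; apply/eqP; rewrite -nsq_eq0 eq_le nsq_ge0 andbT.
  by rewrite (le_trans (Vlo z))// /V zW mul0mx mxE mulr0.
have [K hK] := bass_feedback_decay d0 (shifted_gramian_sym _ _ _ _) Wu
  (shifted_gramian_lyapunov d B N1).
apply: (@stab_prefactor_le _ _ _ _ _ K) => [|r t t0].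
  by rewrite mulr_ge0 ?addr_ge0 ?sqrtr_ge0// exprn_ge0// ltW.
set E := expmx _; have e0 := expR_gt0 (- (2 * delta) * t).
apply: le_trans (Vlo _) _.
apply: (@le_trans _ _ (10 ^+ d.+1 * kappa * d.+1%:R * delta ^+ (2 * d.+1) *
    (expR (- (2 * delta) * t) * (d.+1%:R * nsq B * delta ^- 2 * nsq r)))).
  rewrite ler_wpM2l//.
    by rewrite !mulr_ge0 ?exprn_ge0 ?ler0n// ltW.
  by rewrite (le_trans (hK r t t0))// ler_wpM2l ?(ltW e0)//; exact: Vup.
have -> : 10 ^+ d.+1 * kappa * d.+1%:R * delta ^+ (2 * d.+1) *
    (expR (- (2 * delta) * t) * (d.+1%:R * nsq B * delta ^- 2 * nsq r)) =
    b * (delta ^+ d) ^+ 2 * expR (- (2 * delta) * t) * nsq r.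
  rewrite -exprM mulnS exprD [(d * 2)%N]mulnC /b; field.
  by rewrite gt_eqF.
rewrite exprMn !ler_wpM2r ?nsq_ge0 ?(ltW e0) ?sqr_ge0//.
rewrite -{1}(sqr_sqrtr b0) lerXn2r ?nnegrE ?sqrtr_ge0 ?addr_ge0 ?sqrtr_ge0//.
by rewrite lerDl.
Qed.

(** * Full row rank and the logarithmic limit *)

Lemma mxrank_ctrbmx1 (R : realType) (n m : nat) (A : 'M[R]_n)
    (B : 'M[R]_(n, m)) : \rank (ctrbmx A B 1) = \rank B.
Proof.
apply/eqP; rewrite eqn_leq; apply/andP; split.
  rewrite (_ : ctrbmx A B 1 = B *m \mxrow_(i < 1) 1%:M) ?mxrankM_maxl//.
  rewrite mul_mxrow /ctrbmx; apply: eq_mxrow => i.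
  by rewrite ord1 expr0 mul1mx mulmx1.
rewrite {1}(_ : B = ctrbmx A B 1 *m \mxcol_(i < 1) 1%:M) ?mxrankM_maxl//.
by rewrite /ctrbmx mul_mxrow_mxcol big_ord1 expr0 mul1mx mulmx1.
Qed.

(** A right inverse of B makes every closed-loop matrix available, in
    particular - delta times the identity. *)
Lemma stab_prefactor_row_free (R : realType) (n m : nat) (A : 'M[R]_n)
    (B : 'M[R]_(n, m)) (delta : R) : (0 < n)%N -> row_free B ->
  stab_prefactor A B delta = 1%E.
Proof.
move=> n0 /row_freeP[X BX]; apply/eqP; rewrite eq_le stab_prefactor_ge1// andbT.
apply: (@stab_prefactor_le _ _ _ _ _ (X *m (- A - delta%:M))) => // r t t0.
have -> : A + B *m (X *m (- A - delta%:M)) = (- delta)%:M.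
  by rewrite mulmxA BX mul1mx addrA subrr add0r raddfN.
have hF (s : 'rV[R]_n) : (s *m ((- delta)%:M *m 1%:M + 1%:M *m (- delta)%:M^T)
    *m s^T) 0 0 <= - (2 * delta) * (s *m 1%:M *m s^T) 0 0.
  rewrite mulmx1 mul1mx tr_scalar_mx mulmx1 -raddfD /= mul_mx_scalar -scalemxAl.
  by rewrite mxE -opprD -mulr2n -[delta *+ 2]mulr_natl.
have := lyapunov_decay hF r t0.
by rewrite !mulmx1 -!nsqE expr1n mul1r.
Qed.

Lemma ln_cvgy (R : realType) : (@ln R) x @[x --> +oo%R] --> +oo%R.
Proof.
apply/cvgryPge => a; near=> x.
have ax : expR a <= x.
  by near: x; apply: nbhs_pinfty_ge; rewrite num_real.
by rewrite -[a]expRK ler_ln ?posrE ?expR_gt0// (lt_le_trans (expR_gt0 a)).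
Unshelve. all: by end_near. Qed.

(** The logarithm of c * delta^d is ln c + d ln delta: the constants
    disappear after division by ln delta. *)
Lemma cvg_lne_ratio (R : realType) (P : R -> \bar R) (c C delta0 : R) (d : nat) :
  0 < c -> 0 < C -> (forall delta, delta0 <= delta ->
    ((c * delta ^+ d)%:E <= P delta)%E /\ (P delta <= (C * delta ^+ d)%:E)%E) ->
  (lne (P delta) / (ln delta)%:E)%E @[delta --> +oo%R] --> (d%:R%:E : \bar R).
Proof.
move=> c0 C0 hP.
have bnd (delta : R) : 1 < delta -> delta0 <= delta ->
    exists2 p : R, (lne (P delta) / (ln delta)%:E)%E = p%:E &
      ln c * (ln delta)^-1 + d%:R <= p <= ln C * (ln delta)^-1 + d%:R.
  move=> d1 /hP; have d0 : 0 < delta by exact: lt_trans ltr01 d1.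
  have l0 := ln_gt0 d1; have dn : 0 < delta ^+ d by rewrite exprn_gt0.
  case: (P delta) => [p| |] []; rewrite ?lee_fin => // h1 h2.
  have p0 : 0 < p by apply: lt_le_trans h1; rewrite mulr_gt0.
  exists (ln p / ln delta).
    by rewrite lne_EFin// inver gt_eqF.
  have lnE (a : R) : 0 < a ->
      ln a * (ln delta)^-1 + d%:R = ln (a * delta ^+ d) / ln delta.
    move=> a0; rewrite lnM ?posrE// lnXn// -[ln delta *+ d]mulr_natl mulrDl mulfK//.
    by rewrite gt_eqF.
  rewrite !lnE// !ler_pM2r ?invr_gt0// !ler_ln ?posrE ?mulr_gt0//.
  by rewrite h1 h2.
have hnear : \forall delta \near +oo%R, 1 < delta /\ delta0 <= delta.
  near=> delta; split; near: delta.
    by apply: nbhs_pinfty_gt; rewrite num_real.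
  by apply: nbhs_pinfty_ge; rewrite num_real.
apply: cvg_EFin.
  near=> delta; have [] : 1 < delta /\ delta0 <= delta by near: delta.
  by move=> d1 d2; have [p -> _] := bnd _ d1 d2.
have lim (a : R) : ln a * (ln delta)^-1 + d%:R @[delta --> +oo%R] --> (d%:R : R).
  rewrite -[X in _ --> X](add0r) -[X in _ --> X + _](mulr0 (ln a)).
  apply: cvgD; last exact: cvg_cst.
  apply: cvgM; first exact: cvg_cst.
  apply/gtr0_cvgV0; last exact: ln_cvgy.
  near=> delta; have [d1 _] : 1 < delta /\ delta0 <= delta by near: delta.
  exact: ln_gt0.
apply: (squeeze_cvgr _ (lim c) (lim C)).
near=> delta; have [] : 1 < delta /\ delta0 <= delta by near: delta.
by move=> d1 d2 /=; have [p -> ] := bnd _ d1 d2.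
Unshelve. all: by end_near. Qed.

Theorem theorem1 (R : realType) (n m : nat) (hn : (0 < n)%N)
    (A : 'M[R]_n) (B : 'M[R]_(n, m)) (hAB : controllable A B) :
  (exists c0 C0 delta0 : R, [/\ 0 < c0, 0 < C0, 0 < delta0 &
     forall delta : R, delta0 <= delta ->
       ((c0 * delta ^+ (ctrb_index hAB - 1))%:E
          <= stab_prefactor A B delta)%E /\
       (stab_prefactor A B delta
          <= (C0 * delta ^+ (ctrb_index hAB - 1))%:E)%E]) /\
  (lne (stab_prefactor A B delta) / (ln delta)%:E)%E @[delta --> +oo%R]
     --> (((ctrb_index hAB)%:R - 1)%R%:E : \bar R) /\
  (ctrb_index hAB = 1%N <-> \rank B = n) /\
  (ctrb_index hAB = 1%N ->
     forall delta : R, 0 < delta -> stab_prefactor A B delta = 1%E).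
Proof.
rewrite /ctrb_index; case: ex_minnP => -[//|d] /= rk mind.
rewrite subSS subn0 -natr1 addrK.
have rkd : \rank (ctrbmx A B d) != n.
  case: d mind {rk} => [|d] mind; last first.
    by apply/negP => h; have := mind d.+1 h; rewrite ltnn.
  apply: contraTneq hn => <-; rewrite -leqNgt.
  by rewrite (leq_trans (rank_leq_col _))// big_ord0.
have mu1 : (d.+1 = 1)%N <-> \rank B = n.
  split=> [d1|Bn]; first by rewrite -(mxrank_ctrbmx1 A) -d1; exact/eqP.
  by apply/eqP; rewrite eqn_leq /= mind //= mxrank_ctrbmx1 Bn.
have [c c0 hc] := stab_prefactor_lower rkd.
have [C C0 hC] := stab_prefactor_upper rk.
have bounds (delta : R) : 1 + nsq A <= delta ->
    ((c * delta ^+ d)%:E <= stab_prefactor A B delta)%E /\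
    (stab_prefactor A B delta <= (C * delta ^+ d)%:E)%E.
  move=> hd; have A0 := nsq_ge0 A; have d1 : 1 <= delta by lra.
  split; [apply: hc; lra | apply: hC => //; nra].
split.
  by exists c, C, (1 + nsq A); split=> //; rewrite ltr_wpDr ?nsq_ge0.
split; first exact: cvg_lne_ratio bounds.
split=> // /mu1 Bn delta _; apply: stab_prefactor_row_free => //.
by rewrite /row_free Bn.
Qed.
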